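(* Suppose that $F$ and $H$ satisfy the local Lipschitz conditions (for any $r>0$ there is $L_r>0$ such that $\|F(x_2)-F(x_1)\|\le L_r\|x_2-x_1\|$ and $\|H(x_2)-H(x_1)\|\le L_r\|x_2-x_1\|$ whenever $\|x_1\|,\|x_2\|\le r$), that $\beta,\gamma>0$ satisfy $$S(\beta,\gamma)\le\|x_0,v_{1,0},\dots,v_{k,0}\|+\varepsilon_0\quad\text{and}\quad\big(\|x_0\|+\beta T\|F(0)\|\big)e^{\beta L_{r_0'}T}\le\|x_0\|+\varepsilon_0',$$ and that $l_0^2=O(\tau)$, i.e. $l_0^2\le C_0\tau$ with a constant $C_0$ independent of $\tau$. Let $(x(t),v_1(t),\dots,v_k(t),l(t))$ be the solution on $[0,T]$ of the shrinking-dimer saddle dynamics and $\{x_n,v_{1,n},\dots,v_{k,n}\}_{n=0}^K$ the solution of its explicit Euler/Gram–Schmidt scheme with step size $\tau=T/K$ and the same initial data (both given in the context). Then there is a constant $Q>0$, independent of $\tau$, $n$ and $K$, such that for all sufficiently small $\tau$ $$\max_{1\le n\le K}\Big(\|x(t_n)-x_n\|+\sum_{i=1}^k\|v_i(t_n)-v_{i,n}\|\Big)\le Q\tau.$$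
   Context: Let $N,k\ge1$ be integers, $T>0$, $E:\mathbb R^N\to\mathbb R$ a twice differentiable energy function, $F(x)=-\nabla E(x)$, $H(x)=-\nabla^2E(x)$ (symmetric). $\|\cdot\|$ is the standard $l^2$ norm of a vector or matrix; $\|x,v_1,\dots,v_k\|:=\big(\|x\|^2+\sum_{i=1}^k\|v_i\|^2\big)^{1/2}$; $\mathcal B_r:=\{(x,v_1,\dots,v_k)\in(\mathbb R^N)^{k+1}:\|x,v_1,\dots,v_k\|\le r\}$. Dimer approximation: $\hat H(x,v,l):=\frac{F(x+lv)-F(x-lv)}{2l}$. The initial dimer parameter $l_0=l_0(\tau)>0$ may depend on $\tau$ and is bounded above by a fixed $\bar l$. For every $r>0$ there is a constant $Q_1(r)>0$ with $\|\hat H(x,v,l)-H(x)v\|\le Q_1(r)l^2$ for all $\|x\|\le r$, $\|v\|\le r$, $0<l\le\bar l$. Continuous problem (shrinking-dimer saddle dynamics): on $[0,T]$, $$\frac{dx}{dt}=\beta\Big(I-2\sum_{j=1}^kv_jv_j^\top\Big)F(x),\quad \frac{dv_i}{dt}=\gamma\Big(I-v_iv_i^\top-2\sum_{j=1}^{i-1}v_jv_j^\top\Big)\hat H(x,v_i,l)\ (1\le i\le k),\quad\frac{dl}{dt}=-l,$$ with $x(0)=x_0$, $v_i(0)=v_{i,0}$, $v_{i,0}^\top v_{j,0}=\delta_{i,j}$, $l(0)=l_0$. Discrete problem: $t_n=n\tau$, $\tau=T/K$, $K\in\mathbb N$, $l_n=e^{-t_n}l_0$; for $1\le n\le K$, $$x_n=x_{n-1}+\tau\beta\Big(I-2\sum_{j=1}^kv_{j,n-1}v_{j,n-1}^\top\Big)F(x_{n-1}),$$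 $$\tilde v_{i,n}=v_{i,n-1}+\tau\gamma\Big(I-v_{i,n-1}v_{i,n-1}^\top-2\sum_{j=1}^{i-1}v_{j,n-1}v_{j,n-1}^\top\Big)\hat H(x_{n-1},v_{i,n-1},l_{n-1}),\quad1\le i\le k,$$ $$\{v_{i,n}\}_{i=1}^k=\mathrm{GS}(\{\tilde v_{i,n}\}_{i=1}^k),$$ started from $x_0$ and $v_{i,0}$, where GS is Gram–Schmidt orthonormalization: successively for $i=1,\dots,k$, $v_{i,n}=w_i/\|w_i\|$ with $w_i=\tilde v_{i,n}-\sum_{j<i}(\tilde v_{i,n}^\top v_{j,n})v_{j,n}$. Truncation errors: for $g=x$ or $g=v_i$, $R_n^g:=\frac{g(t_n)-g(t_{n-1})}{\tau}-\frac{dg}{dt}(t_{n-1})$ is supposed to satisfy $\|R_n^g\|=O(\tau)$ uniformly in $n$. Parameter conditions: $\varepsilon_0,\varepsilon_0'>0$, $r_0\ge\|x_0,v_{1,0},\dots,v_{k,0}\|+\varepsilon_0$ and $r_0'\ge\|x_0\|+\varepsilon_0'$ are fixed constants; $\beta,\gamma$ are independent of $\tau$ and the conditions hold for every $l_0$ used. With $V_i(x,v_1,\dots,v_k,l):=\big(I-v_iv_i^\top-2\sum_{j<i}v_jv_j^\top\big)\hat H(x,v_i,l)$: $Q_0(r_0):=\sqrt{k+1}\max\{(1+2kr_0^2)L_{r_0},4r_0(\|F(0)\|+L_{r_0}r_0)\}$; $Q_2(r_0)>0$ is a fixed constant such that $\|V_i(x,v_1,\dots,v_k,l)-V_i(\bar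 x,\bar v_1,\dots,\bar v_k,l)\|\le Q_2(r_0)(\|x-\bar x,v_1-\bar v_1,\dots,v_k-\bar v_k\|+l_0^2)$ for all $1\le i\le k$, all pairs of points in $\mathcal B_{r_0}$ and all $0<l\le l_0$; $Q_3:=(1+2k\sum_{j=1}^k\|v_{j,0}\|^2)\|F(x_0)\|$; $Q_4(r_0):=(1+\|v_{i,0}\|^2+2k\sum_{j=1}^k\|v_{j,0}\|^2)(\|H(x_0)\|\|v_{i,0}\|+Q_1(r_0)l_0^2)$ (independent of $i$ since $\|v_{i,0}\|=1$); $Q_5(r_0):=\beta T(Q_3+Q_0(r_0)r_0)^2+k\gamma T(Q_4(r_0)+Q_2(r_0)r_0+Q_2(r_0)l_0^2)^2$; $Q_6(r_0):=\max\{\beta(1+Q_0(r_0)),\gamma(1+Q_2(r_0))\}+\beta Q_0(r_0)+k\gamma Q_2(r_0)$; $S(\beta,\gamma):=(\|x_0,v_{1,0},\dots,v_{k,0}\|^2+Q_5(r_0))^{1/2}e^{Q_6(r_0)T/2}$. *)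

(* Defs.v *)
From HB Require Import structures.
From mathcomp Require Import all_boot all_order all_algebra.
From mathcomp Require Import all_classical all_reals all_analysis.

Set Implicit Arguments.
Unset Strict Implicit.
Unset Printing Implicit Defensive.

Import Order.TTheory GRing.Theory Num.Theory.
Import numFieldNormedType.Exports.
Local Open Scope classical_set_scope.
Local Open Scope ring_scope.

(* The norm [`|_|] that the library puts on ['M[R]_(m, n)] is the sup norm; it
   is used below only through the (equivalent) topology it induces.  All
   estimates are written with the Euclidean norm [l2norm] and with the matrix
   norm [opnorm] that it induces (the spectral norm). *)
Section Norms.
Variable R : realType.

Definition dot n (u w : 'cV[R]_n) : R := (u^T *m w) 0 0.

Definition l2norm n (u : 'cV[R]_n) : R := Num.sqrt (\sum_i u i 0 ^+ 2).

Definition opnorm m n (A : 'M[R]_(m, n)) : R :=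
  sup [set l2norm (A *m u) | u in [set u : 'cV[R]_n | l2norm u <= 1]].

(* ||x, v_1, ..., v_k|| *)
Definition pnorm n k (x : 'cV[R]_n) (v : 'I_k -> 'cV[R]_n) : R :=
  Num.sqrt (l2norm x ^+ 2 + \sum_i l2norm (v i) ^+ 2).

End Norms.

(* Derivative of a function on a subset [A] of the line: the difference
   quotient is restricted to [A], so that it is one-sided at an end point of
   a closed interval. *)
Section DerivativeOn.
Variables (R : realType) (V : normedModType R).
Implicit Types (A : set R) (g : R -> V) (t : R).

Definition diff_quot g t (s : R) : V := (s - t)^-1 *: (g s - g t).

Definition derivable_on A g t : Prop := cvg (diff_quot g t @ within A t^').

Definition derive_on A g t : V := lim (diff_quot g t @ within A t^').

End DerivativeOn.

Section Energy.
Variables (R : realType) (N : nat).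
Implicit Types (E : 'cV[R]_N -> R) (x : 'cV[R]_N).

Definition grad E x : 'cV[R]_N := \col_i 'D_(delta_mx i 0) E x.

Definition hess E x : 'M[R]_N :=
  \matrix_(i, j) ('D_(delta_mx j 0) (grad E) x) i 0.

Definition twice_differentiable E : Prop :=
  (forall x, differentiable E x) /\ (forall x, differentiable (grad E) x).

Definition force E x : 'cV[R]_N := - grad E x.

Definition nhess E x : 'M[R]_N := - hess E x.

Definition local_lipschitz E (L : R -> R) : Prop :=
  forall r, 0 < r -> 0 < L r /\
    forall x1 x2, l2norm x1 <= r -> l2norm x2 <= r ->
      l2norm (force E x2 - force E x1) <= L r * l2norm (x2 - x1) /\
      opnorm (nhess E x2 - nhess E x1) <= L r * l2norm (x2 - x1).

(* dimer approximation of H(x) v *)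
Definition dimer E x (v : 'cV[R]_N) (l : R) : 'cV[R]_N :=
  (2 * l)^-1 *: (force E (x + l *: v) - force E (x - l *: v)).

Definition dimer_consistent E (lbar : R) (Q1 : R -> R) : Prop :=
  forall r, 0 < r -> 0 < Q1 r /\
    forall x v l, l2norm x <= r -> l2norm v <= r -> 0 < l -> l <= lbar ->
      l2norm (dimer E x v l - nhess E x *m v) <= Q1 r * l ^+ 2.

End Energy.

Section Dynamics.
Variables (R : realType) (N k : nat).
Variables (E : 'cV[R]_N -> R) (beta gamma T : R).
Implicit Types (x : 'cV[R]_N) (v : 'I_k -> 'cV[R]_N) (l tau : R).

Definition xdir x v : 'cV[R]_N :=
  (1%:M - 2 *: \sum_j v j *m (v j)^T) *m force E x.

Definition vdir (i : 'I_k) x v l : 'cV[R]_N :=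
  (1%:M - v i *m (v i)^T - 2 *: \sum_(j < k | (j < i)%N) v j *m (v j)^T)
    *m dimer E x (v i) l.

Definition sd_solution x0 v0 (l0 : R)
    (X : R -> 'cV[R]_N) (V : 'I_k -> R -> 'cV[R]_N) (l : R -> R) : Prop :=
  [/\ X 0 = x0, forall i, V i 0 = v0 i, l 0 = l0 &
  forall t, 0 <= t <= T ->
    [/\ derivable_on `[0, T] X t /\
          derive_on `[0, T] X t = beta *: xdir (X t) (V ^~ t),
        forall i, derivable_on `[0, T] (V i) t /\
          derive_on `[0, T] (V i) t = gamma *: vdir i (X t) (V ^~ t) (l t) &
        derivable_on `[0, T] (l : R -> R^o) t /\
          derive_on `[0, T] (l : R -> R^o) t = - l t]].

(* [v] is determined by [vt] through induction on [i].  In the degenerate case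
   [w = 0] the convention [0^-1 = 0] gives [v i = 0], so that the relation is
   satisfiable for every [vt]. *)
Definition gram_schmidt (vt v : 'I_k -> 'cV[R]_N) : Prop :=
  forall i, let w := vt i - \sum_(j < k | (j < i)%N) dot (vt i) (v j) *: v j in
    v i = (l2norm w)^-1 *: w.

Definition step (K : nat) : R := T / K%:R.

Definition euler_gs_solution x0 v0 (l0 : R) (K : nat)
    (X : nat -> 'cV[R]_N) (V : nat -> 'I_k -> 'cV[R]_N) : Prop :=
  let tau := step K in
  [/\ X 0%N = x0, forall i, V 0%N i = v0 i &
  forall n, (n < K)%N ->
    X n.+1 = X n + tau *: (beta *: xdir (X n) (V n)) /\
    gram_schmidt
      (fun i => V n i +
         tau *: (gamma *: vdir i (X n) (V n) (expR (- (n%:R * tau)) * l0)))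
      (V n.+1)].

(* R_n^g for n = m + 1 *)
Definition trunc_err (K : nat) (g : R -> 'cV[R]_N) (m : nat) : 'cV[R]_N :=
  let tau := step K in
  tau^-1 *: (g (m.+1%:R * tau) - g (m%:R * tau))
    - derive_on `[0, T] g (m%:R * tau).

End Dynamics.

Section Constants.
Variables (R : realType) (N k : nat).
Variables (E : 'cV[R]_N -> R) (beta gamma T : R) (L Q1 : R -> R).
Variables (x0 : 'cV[R]_N) (v0 : 'I_k -> 'cV[R]_N) (r0 Q2 l0 : R).

Definition vdir_lipschitz : Prop :=
  forall (i : 'I_k) x (v : 'I_k -> 'cV[R]_N) y (w : 'I_k -> 'cV[R]_N) l,
    pnorm x v <= r0 -> pnorm y w <= r0 -> 0 < l -> l <= l0 ->
    l2norm (vdir E i x v l - vdir E i y w l)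
      <= Q2 * (pnorm (x - y) (fun j => v j - w j) + l0 ^+ 2).

Definition Q0 : R :=
  Num.sqrt k.+1%:R *
  Num.max ((1 + 2 * k%:R * r0 ^+ 2) * L r0)
          (4 * r0 * (l2norm (force E 0) + L r0 * r0)).

Definition Q3 : R :=
  (1 + 2 * k%:R * \sum_j l2norm (v0 j) ^+ 2) * l2norm (force E x0).

(* For orthonormal [v0] the value of [Q4 i] does not depend on [i], and neither
   do those of [Q5 i] and [Sbound i]. *)
Definition Q4 (i : 'I_k) : R :=
  (1 + l2norm (v0 i) ^+ 2 + 2 * k%:R * \sum_j l2norm (v0 j) ^+ 2)
  * (opnorm (nhess E x0) * l2norm (v0 i) + Q1 r0 * l0 ^+ 2).

Definition Q5 (i : 'I_k) : R :=
  beta * T * (Q3 + Q0 * r0) ^+ 2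
  + k%:R * gamma * T * (Q4 i + Q2 * r0 + Q2 * l0 ^+ 2) ^+ 2.

Definition Q6 : R :=
  Num.max (beta * (1 + Q0)) (gamma * (1 + Q2)) + beta * Q0 + k%:R * gamma * Q2.

Definition Sbound (i : 'I_k) : R :=
  Num.sqrt (pnorm x0 v0 ^+ 2 + Q5 i) * expR (Q6 * T / 2).

End Constants.

(* Main.v *)
Require Import Defs.
From HB Require Import structures.
From mathcomp Require Import all_boot all_order all_algebra.
From mathcomp Require Import all_classical all_reals all_analysis.
From mathcomp Require Import ring lra.

Import Order.TTheory GRing.Theory Num.Theory.
Import numFieldNormedType.Exports.
Local Open Scope classical_set_scope.
Local Open Scope ring_scope.

(** The proof is the stability-plus-consistency argument for a one-step method,
    applied to the error [e_n = |x(t_n) - x_n| + sum_i |v_i(t_n) - v_{i,n}|].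
    One step gives [e_{n+1} <= (1 + A tau) e_n + B tau^2], and the discrete
    Gronwall inequality turns this into [e_n <= Q tau].  Three contributions
    enter [B tau^2]: the truncation error, the dimer error [tau l^2], which is
    O(tau^2) because [l_0^2 = O(tau)], and the Gram-Schmidt correction.

    The correction is quadratic in [tau] for a structural reason.  If the
    [v_{i,n}] are orthonormal, then the first variation of the Gram matrix of
    the predictors is [v_i . H v_j - v_j . H v_i] up to the dimer error, and it
    vanishes since the Hessian is symmetric ([nhess_sym], Schwarz's theorem).
    So the predictors are orthonormal up to O(tau^2) ([gram_predictor]), and
    Gram-Schmidt moves a nearly orthonormal family by an amount proportional to
    its defect ([gram_schmidt_near]).

    The constants [A] and [B] come from local Lipschitz bounds, so all points
    have to remain in one ball.  For the scheme this is global: its directions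
    are unit vectors, and the position moves along a reflection of the force,
    which has the norm of the force, so that [x_n] obeys the linear growth
    estimate whose value at [T] is bounded by [|x_0| + eps_0']
    ([position_growth]).  The exact solution is not bounded separately: as long
    as [e_n <= Q tau <= 1] it lies within distance 1 of the scheme, and this
    information is carried along in the same induction.

    The dimer lengths of the two problems agree at the grid points, because
    [dl/dt = - l] has only the solution [l_0 exp(-t)] ([dimer_length]). *)

(** * Euclidean geometry of column vectors *)

Section Euclidean.
Context {R : realType} {n : nat}.
Implicit Types (u w f : 'cV[R]_n) (a : R).

Lemma dotE u w : dot u w = \sum_i u i 0 * w i 0.
Proof. by rewrite /dot mxE; apply: eq_bigr => i _; rewrite mxE. Qed.

Lemma dotC u w : dot u w = dot w u.
Proof. by rewrite !dotE; apply: eq_bigr => i _; rewrite mulrC. Qed.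

Lemma dotDl u1 u2 w : dot (u1 + u2) w = dot u1 w + dot u2 w.
Proof. by rewrite /dot linearD mulmxDl mxE. Qed.

Lemma dotZl a u w : dot (a *: u) w = a * dot u w.
Proof. by rewrite /dot linearZ -scalemxAl mxE. Qed.

Lemma dotNl u w : dot (- u) w = - dot u w.
Proof. by rewrite -scaleN1r dotZl mulN1r. Qed.

Lemma dotBl u1 u2 w : dot (u1 - u2) w = dot u1 w - dot u2 w.
Proof. by rewrite dotDl dotNl. Qed.

Lemma dotDr u w1 w2 : dot u (w1 + w2) = dot u w1 + dot u w2.
Proof. by rewrite dotC dotDl !(dotC u). Qed.

Lemma dotZr a u w : dot u (a *: w) = a * dot u w.
Proof. by rewrite dotC dotZl (dotC u). Qed.

Lemma dotNr u w : dot u (- w) = - dot u w.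
Proof. by rewrite dotC dotNl (dotC u). Qed.

Lemma dotBr u w1 w2 : dot u (w1 - w2) = dot u w1 - dot u w2.
Proof. by rewrite dotDr dotNr. Qed.

Lemma dot_sumr (I : finType) (P : pred I) u (g : I -> 'cV[R]_n) :
  dot u (\sum_(i | P i) g i) = \sum_(i | P i) dot u (g i).
Proof.
by elim/big_rec2 : _ => [|i y1 y2 _ <-]; rewrite ?dotDr // /dot mulmx0 mxE.
Qed.

Lemma l2norm_ge0 u : 0 <= l2norm u.
Proof. exact: sqrtr_ge0. Qed.

Lemma l2norm_sqr u : l2norm u ^+ 2 = dot u u.
Proof.
by rewrite /l2norm sqr_sqrtr ?dotE// sumr_ge0// => i _; rewrite sqr_ge0.
Qed.

Lemma dot_ge0 u : 0 <= dot u u.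
Proof. by rewrite -l2norm_sqr sqr_ge0. Qed.

Lemma l2norm_eq0 u : l2norm u = 0 -> u = 0.
Proof.
move=> u0; apply/matrixP => i j; rewrite ord1 mxE; apply/eqP.
rewrite -sqrf_eq0; apply/eqP.
have : \sum_i u i 0 ^+ 2 = 0 by have := l2norm_sqr u; rewrite u0 expr0n dotE.
by move/psumr_eq0P => -> // ? _; exact: sqr_ge0.
Qed.

Lemma cauchy_schwarz u w : `|dot u w| <= l2norm u * l2norm w.
Proof.
have [w0|w0] := eqVneq (l2norm w) 0.
  by rewrite (l2norm_eq0 _ w0) /dot mulmx0 mxE normr0 mulr_ge0// l2norm_ge0.
have w2 : 0 < dot w w by rewrite -l2norm_sqr exprn_gt0// lt0r w0 l2norm_ge0.
rewrite -(ler_pXn2r (ltn0Sn 1)) ?nnegrE ?mulr_ge0 ?l2norm_ge0//.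
rewrite -normrX ger0_norm ?sqr_ge0// exprMn !l2norm_sqr.
(* Up to the factor [dot w w], the component of [u] orthogonal to [w]. *)
have := dot_ge0 (dot w w *: u - dot u w *: w).
rewrite !(dotBl, dotBr, dotZl, dotZr) (dotC w u) => h.
have {}h : 0 <= dot w w * (dot u u * dot w w - dot u w ^+ 2) by lra.
by rewrite pmulr_rge0// subr_ge0 in h.
Qed.

Lemma l2norm0 : l2norm (0 : 'cV[R]_n) = 0.
Proof.
by apply/eqP; rewrite -sqrf_eq0 l2norm_sqr /dot mulmx0 mxE.
Qed.

Lemma l2normZ a u : l2norm (a *: u) = `|a| * l2norm u.
Proof.
apply/eqP; rewrite -(eqrXn2 (ltn0Sn 1)) ?mulr_ge0 ?l2norm_ge0//.
by rewrite exprMn !l2norm_sqr dotZl dotZr real_normK ?num_real// expr2 mulrA.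
Qed.

Lemma l2normN u : l2norm (- u) = l2norm u.
Proof. by rewrite -scaleN1r l2normZ normrN1 mul1r. Qed.

Lemma l2normBC u w : l2norm (u - w) = l2norm (w - u).
Proof. by rewrite -l2normN opprB. Qed.

Lemma l2normD u w : l2norm (u + w) <= l2norm u + l2norm w.
Proof.
rewrite -(ler_pXn2r (ltn0Sn 1)) ?nnegrE ?addr_ge0 ?l2norm_ge0//.
rewrite l2norm_sqr sqrrD !l2norm_sqr dotDl !dotDr (dotC w u).
have := le_trans (ler_norm _) (cauchy_schwarz u w); lra.
Qed.

Lemma l2normB u w : l2norm (u - w) <= l2norm u + l2norm w.
Proof. by rewrite (le_trans (l2normD _ _))// l2normN. Qed.

Lemma l2norm_le_dist u w : l2norm u <= l2norm w + l2norm (u - w).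
Proof. by rewrite -{1}(subrK w u) addrC l2normD. Qed.

Lemma l2norm_sum (I : finType) (P : pred I) (g : I -> 'cV[R]_n) :
  l2norm (\sum_(i | P i) g i) <= \sum_(i | P i) l2norm (g i).
Proof.
elim/big_rec2 : _ => [|i y1 y2 _ h]; first by rewrite l2norm0.
by rewrite (le_trans (l2normD _ _))// lerD2l.
Qed.

Lemma l2norm_unit u : dot u u = 1 -> l2norm u = 1.
Proof.
move=> u1; apply/eqP; rewrite -(eqrXn2 (ltn0Sn 1)) ?l2norm_ge0//.
by rewrite l2norm_sqr u1 expr1n.
Qed.

(** For a unit vector [u] this is the orthogonal projection onto [u]. *)
Lemma mulmx_dyad u f : u *m u^T *m f = dot u f *: u.
Proof. by rewrite -mulmxA [u^T *m f]mx11_scalar mul_mx_scalar. Qed.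

End Euclidean.

(** Finite dimension makes the set whose supremum is [opnorm A] bounded; its
    Frobenius norm is such a bound. *)
Lemma opnorm_mulmx {R : realType} m n (A : 'M[R]_(m, n)) (u : 'cV[R]_n) :
  l2norm (A *m u) <= opnorm A * l2norm u.
Proof.
set B := [set l2norm (A *m w) | w in [set w : 'cV[R]_n | l2norm w <= 1]].
have Bub : has_ubound B.
  exists (Num.sqrt (\sum_i l2norm (row i A)^T ^+ 2)) => _ /= [w w1 <-].
  apply: ler_wsqrtr; apply: ler_sum => i _.
  have -> : (A *m w) i 0 = dot (row i A)^T w.
    by rewrite dotE mxE; apply: eq_bigr => j _; rewrite !mxE.
  rewrite -[X in X <= _]ger0_norm ?sqr_ge0// normrX.
  rewrite ler_pXn2r ?nnegrE ?l2norm_ge0//.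
  by rewrite (le_trans (cauchy_schwarz _ _))// ler_piMr// l2norm_ge0.
have [u0|u0] := eqVneq (l2norm u) 0.
  by rewrite (l2norm_eq0 _ u0) mulmx0 !l2norm0 mulr0.
have lu : 0 < l2norm u by rewrite lt0r u0 l2norm_ge0.
have lu' : 0 <= (l2norm u)^-1 by rewrite invr_ge0 ltW.
have : B (l2norm (A *m ((l2norm u)^-1 *: u))).
  by exists ((l2norm u)^-1 *: u) => //=; rewrite l2normZ ger0_norm// mulVf.
move/(ub_le_sup Bub); rewrite -/(opnorm A) -scalemxAr l2normZ ger0_norm//.
by rewrite mulrC ler_pdivrMr.
Qed.

(** * Symmetry of the Hessian *)

Section MixedDerivatives.
Context {R : realType} {U : normedModType R}.
Implicit Types (f : U -> R) (x u w : U).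

Lemma is_derive_line f x u (s : R) :
  derivable f (x + s *: u) u ->
  is_derive s 1 (fun r : R => f (x + r *: u)) ('D_u f (x + s *: u)).
Proof.
move=> df; pose q (h : R) := h^-1 *: (f (h *: u + (x + s *: u)) - f (x + s *: u)).
have qE : (fun h : R => h^-1 *: (f (x + (h *: (1 : R) + s) *: u) -
                                 f (x + s *: u))) = q.
  apply/funext => h; rewrite /q; congr (_ *: (f _ - _)).
  by rewrite scalerDl [h *: (1 : R)]mulr1 addrCA.
by apply: DeriveDef; rewrite /derivable /derive /= qE.
Qed.

Lemma MVT_line f x u (s : R) : 0 < s ->
  (forall y, derivable f y u) ->
  exists2 c, 0 < c < s & f (x + s *: u) - f x = s * 'D_u f (x + c *: u).
Proof.
move=> s0 df.
have dline r := is_derive_line f x u r (df _).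
have [|c cs] := MVT s0 (fun r _ => dline r).
  by apply: derivable_within_continuous => r _; case: (dline r).
rewrite scale0r addr0 subr0 mulrC => h; exists c => //.
Qed.

(** The second difference of [f] over the parallelogram with sides [s u] and
    [s w] is [s^2] times a mixed derivative at some point of it, whichever of
    the two sides the mean value theorem is applied to first. *)
Lemma mixed_derivatives_meet f x u w (s : R) : 0 < s ->
  (forall y, derivable f y u) -> (forall y, derivable f y w) ->
  (forall y, derivable ('D_u f) y w) -> (forall y, derivable ('D_w f) y u) ->
  exists a b c d : R,
    [/\ 0 < a < s, 0 < b < s, 0 < c < s, 0 < d < s &
        'D_w ('D_u f) (x + a *: u + b *: w) =
        'D_u ('D_w f) (x + c *: w + d *: u)].
Proof.
have second_diff u' w' : 0 < s ->
    (forall y, derivable f y u') -> (forall y, derivable ('D_u' f) y w') ->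
    exists a b : R, [/\ 0 < a < s, 0 < b < s &
      f (x + s *: u' + s *: w') - f (x + s *: u') - (f (x + s *: w') - f x) =
      s * (s * 'D_w' ('D_u' f) (x + a *: u' + b *: w'))].
  move=> s0 du dwu.
  pose g y := f (y + s *: w') - f y.
  have dshift y : is_derive y u' (fun z => f (z + s *: w'))
                    ('D_u' f (y + s *: w')).
    pose q (h : R) := h^-1 *: (f (h *: u' + (y + s *: w')) - f (y + s *: w')).
    have qE : (fun h : R => h^-1 *: (f (h *: u' + y + s *: w') -
                                 f (y + s *: w'))) = q.
      by apply/funext => h; rewrite /q addrA.
    by apply: DeriveDef; rewrite /derivable /derive /= qE //; exact: du.
  have dg y : is_derive y u' g ('D_u' f (y + s *: w') - 'D_u' f y).
    have fy : is_derive y u' f ('D_u' f y) by exact: DeriveDef.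
    exact: (is_deriveB _ fy).
  have [a ha] := MVT_line g x u' s s0 (fun y => let: DeriveDef h _ := dg y in h).
  have [_ ->] := dg (x + a *: u').
  have [b hb ->] := MVT_line ('D_u' f) (x + a *: u') w' s s0 dwu.
  by move=> h; exists a, b; split.
move=> s0 du dw dwu duw.
have [a [b [ha hb e1]]] := second_diff u w s0 du dwu.
have [c [d [hc hd e2]]] := second_diff w u s0 dw duw.
exists a, b, c, d; split; [exact: ha|exact: hb|exact: hc|exact: hd|].
apply: (mulfI (lt0r_neq0 s0)); apply: (mulfI (lt0r_neq0 s0)).
apply: etrans (esym e1) _; apply: etrans _ e2.
have -> : x + s *: w + s *: u = x + s *: u + s *: w by exact: addrAC.
have swap (p q r t : R) : p - q - (r - t) = p - r - (q - t) by ring.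
exact: swap.
Qed.

End MixedDerivatives.

Lemma l2norm_delta {R : realType} {n : nat} (i : 'I_n) :
  l2norm (delta_mx i 0 : 'cV[R]_n) = 1.
Proof.
apply: l2norm_unit; rewrite dotE (bigD1 i)//= big1 => [|j ji].
  by rewrite mxE !eqxx mulr1 addr0.
by rewrite mxE (negbTE ji) mul0r.
Qed.

Lemma entry_le_opnorm {R : realType} {m n : nat} (A : 'M[R]_(m, n)) i j :
  `|A i j| <= opnorm A.
Proof.
have -> : A i j = dot (delta_mx i 0) (A *m delta_mx j 0).
  by rewrite -colE dotE (bigD1 i)//= big1 => [|l li];
    rewrite !mxE ?eqxx ?(negbTE li) ?mul0r// mul1r addr0.
rewrite (le_trans (cauchy_schwarz _ _))// l2norm_delta mul1r.
by rewrite (le_trans (opnorm_mulmx _ _ _ _))// l2norm_delta mulr1.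
Qed.

Lemma eq_of_dist_le {R : realFieldType} (a b c : R) :
  (forall s, 0 < s -> s <= 1 -> `|a - b| <= c * s) -> a = b.
Proof.
move=> h; apply/eqP; rewrite -subr_eq0 -normr_le0.
rewrite leNgt; apply/negP => ab0.
have := h 1 ltr01 (lexx _); rewrite mulr1 => hc.
have c0 : 0 < c by exact: lt_le_trans hc.
have := h (`|a - b| / (2 * c)); rewrite divr_gt0 ?mulr_gt0//.
rewrite ler_pdivrMr ?mulr_gt0// mul1r => /(_ isT).
have -> : `|a - b| <= 2 * c by lra.
move/(_ isT); have -> : c * (`|a - b| / (2 * c)) = `|a - b| / 2.
  by field; rewrite gt_eqF.
lra.
Qed.

(** Schwarz's theorem, with the continuity of the second derivatives supplied
    by the local Lipschitz condition on the Hessian. *)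
Lemma nhess_sym {R : realType} {N : nat} (E : 'cV[R]_N -> R) (L : R -> R) x :
  twice_differentiable E -> local_lipschitz E L -> (nhess E x)^T = nhess E x.
Proof.
move=> [dE dgE] hL.
have gradE i : (fun z => grad E z i 0) = 'D_(delta_mx i 0) E.
  by apply/funext => z; rewrite mxE.
have entry y i j : hess E y i j = 'D_(delta_mx j 0) ('D_(delta_mx i 0) E) y.
  rewrite mxE derive_mx; last exact/diff_derivable.
  by rewrite mxE gradE.
have dE2 y i j : derivable ('D_(delta_mx i 0) E) y (delta_mx j 0).
  have /derivable_mxP /(_ i 0) : derivable (grad E) y (delta_mx j 0).
    exact/diff_derivable.
  by rewrite gradE.
suff sym : forall i j, hess E x i j = hess E x j i.
  by apply/matrixP => i j; rewrite mxE [LHS]mxE [RHS]mxE sym.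
move=> i j.
pose r := l2norm x + 2.
have r0 : 0 < r by rewrite ltr_wpDl// l2norm_ge0.
have [Lr0 lip] := hL r r0.
have near_hess y s i' j' : 0 < s -> s <= 1 -> l2norm (y - x) <= 2 * s ->
    `|hess E y i' j' - hess E x i' j'| <= L r * (2 * s).
  move=> s0 s1 yx; have -> : hess E y i' j' - hess E x i' j' =
      (nhess E x - nhess E y) i' j'.
    by rewrite /nhess opprK addrC [RHS]mxE [in RHS]mxE.
  rewrite (le_trans (entry_le_opnorm _ _ _))//.
  have xr : l2norm x <= r by rewrite lerDl.
  have yr : l2norm y <= r.
    by rewrite (le_trans (l2norm_le_dist y x))// lerD2l (le_trans yx)//; lra.
  by rewrite (le_trans (lip _ _ yr xr).2)// l2normBC ler_wpM2l// ltW.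
apply: (@eq_of_dist_le _ _ _ (4 * L r)) => s s0 s1.
have near_x p q (a' b' : R) : 0 < a' < s -> 0 < b' < s ->
    l2norm (x + a' *: delta_mx p 0 + b' *: delta_mx q 0 - x) <= 2 * s.
  move=> /andP[a0 a1] /andP[b0 b1].
  have cancel (y z : 'cV[R]_N) : x + y + z - x = y + z.
    by rewrite (addrAC (x + y)) (addrAC x y) subrr add0r.
  rewrite cancel; apply: le_trans (l2normD _ _) _.
  rewrite !l2normZ !l2norm_delta !mulr1 !gtr0_norm//; lra.
have [||||a [b [c [d [ha hb hc hd e]]]]] :=
  @mixed_derivatives_meet R 'cV[R]_N E x (delta_mx i 0) (delta_mx j 0) s s0.
- by move=> y; exact/diff_derivable.
- by move=> y; exact/diff_derivable.
- by move=> y; exact: dE2.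
- by move=> y; exact: dE2.
have hp := near_x i j a b ha hb; have hq := near_x j i c d hc hd.
have {}e := etrans (entry _ _ _) (etrans e (esym (entry _ _ _))).
move: (x + _ + _) (x + _ + _) hp hq e => q p hp hq e.
have close (u' v' w' z' m : R) : u' = w' -> `|u' - v'| <= m ->
    `|w' - z'| <= m -> `|v' - z'| <= m + m.
  by move=> <- h1 h2; rewrite (le_trans (ler_distD u' _ _))// lerD// distrC.
have -> : 4 * L r * s = L r * (2 * s) + L r * (2 * s) by ring.
by apply: (close _ _ _ _ _ e); apply: near_hess.
Qed.

(** * Decay of the dimer length *)

(** The product of [l t] with [exp t] has zero derivative inside [0, T], so it
    is constant there by the mean value theorem; continuity at the end points
    follows from the one-sided difference quotients. *)
Lemma dimer_length {R : realType} (T : R) (l : R -> R) :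
  (forall t, 0 <= t <= T ->
     derivable_on `[0, T] (l : R -> R^o) t /\
     derive_on `[0, T] (l : R -> R^o) t = - l t) ->
  forall t, 0 <= t <= T -> l t = l 0 * expR (- t).
Proof.
move=> hl.
have lcvg t : 0 <= t <= T -> forall e, 0 < e -> exists2 d, 0 < d &
    forall s, 0 <= s <= T -> s != t -> `|s - t| < d ->
      `|- l t - (s - t)^-1 * (l s - l t)| <= e.
  move=> ht e e0; have [dl le] := hl t ht.
  have : (diff_quot (l : R -> R^o) t @ within `[0, T] t^') --> - l t.
    by rewrite -le; exact: dl.
  move/cvgrPdist_le => /(_ _ e0)[d /= d0 h]; exists d => // s s01 st sd.
  have := h s; rewrite /ball /= distrC => /(_ sd st).
  by rewrite in_itv /= s01; exact.
have lcont t : 0 <= t <= T ->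
    l x @[x --> within `[0, T] (nbhs t)] --> l t.
  move=> ht; apply/cvgrPdist_le => e e0.
  have [d d0 hd] := lcvg t ht 1 ltr01.
  have d1 : 0 < e / (1 + `|l t|) by rewrite divr_gt0// ltr_wpDr.
  rewrite near_withinE; near=> s; rewrite /= in_itv /= => s01.
  have [->|st] := eqVneq s t; first by rewrite subrr normr0 ltW.
  have sd : `|s - t| < d.
    by rewrite distrC; near: s; exact: (nbhsx_ballx t d d0).
  have sd1 : `|s - t| < e / (1 + `|l t|).
    by rewrite distrC; near: s; exact: (nbhsx_ballx t _ d1).
  have st0 : s - t != 0 by rewrite subr_eq0.
  have -> : l t - l s =
      (s - t) * ((- l t - (s - t)^-1 * (l s - l t)) + l t) by field.
  rewrite normrM (@le_trans _ _ (`|s - t| * (1 + `|l t|)))//.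
    by rewrite ler_wpM2l// (le_trans (ler_normD _ _))// lerD2r hd.
  by rewrite -ler_pdivlMr ?ltr_wpDr// ltW.
move=> t /andP[t0 tT].
pose g (s : R) := l s * expR s.
have gder s : s \in `]0, t[%R -> is_derive s 1 g 0.
  rewrite in_itv /= => /andP[s0 st].
  have sT : 0 <= s <= T by rewrite ltW//= (le_trans (ltW st)).
  have dls : is_derive s 1 l (- l s).
    have q : h^-1 *: (l (h *: 1 + s) - l s) @[h --> (0:R)^'] --> - l s.
      apply/cvgrPdist_le => e e0; have [d d0 hd] := lcvg s sT e e0.
      near=> h; have h0 : h != 0 by near: h; exact: nbhs_dnbhs_neq.
      have -> : h^-1 *: (l (h *: (1 : R) + s) - l s) =
        (h + s - s)^-1 * (l (h + s) - l s) by rewrite [h *: _]mulr1 addrK.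
      apply: hd; rewrite ?addrK//.
      + have : `|h| <= s by near: h; exact: dnbhs0_le.
        have : `|h| <= t - s by near: h; apply: dnbhs0_le; rewrite subr_gt0.
        rewrite !ler_norml => /andP[_ h1] /andP[h2 _].
        by apply/andP; split; lra.
      + by rewrite -subr_eq0 addrK.
      + by near: h; exact: dnbhs0_lt.
    by apply: DeriveDef; [apply/cvg_ex; exists (- l s)|exact/cvg_lim].
  have dgs := is_deriveM dls (is_derive_expR s).
  apply: is_derive_eq; rewrite /GRing.scale /=; ring.
have gcont : {within `[0, t], continuous g}.
  apply/subspace_continuousP => s; rewrite /= in_itv /= => /andP[s0 st].
  apply: cvgM; last by apply: cvg_within_filter; exact: continuous_expR.
  apply: cvg_trans (lcont s _); last by rewrite s0 (le_trans st).
  apply: cvg_app.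
  by apply: within_subset => r /=; rewrite !in_itv /= => /andP[-> /le_trans ->].
have [c _] := MVT_segment t0 gder gcont.
rewrite mul0r /g expR0 mulr1 => /eqP; rewrite subr_eq0 => /eqP <-.
by rewrite -mulrA -expRD subrr expR0 mulr1.
Unshelve. all: by end_near. Qed.

(** * Gram-Schmidt applied to a nearly orthonormal family *)

Definition orthonormal_family {R : realType} {n k : nat} (v : 'I_k -> 'cV[R]_n) :=
  forall i j, dot (v i) (v j) = (i == j)%:R.

Lemma orthonormal_l2norm {R : realType} {n k : nat} (v : 'I_k -> 'cV[R]_n) i :
  orthonormal_family v -> l2norm (v i) = 1.
Proof. by move=> ov; apply: l2norm_unit; rewrite ov eqxx. Qed.

Lemma sum_le_const {R : realType} {k : nat} (P : pred 'I_k) (f : 'I_k -> R) c :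
  0 <= c -> (forall i, P i -> f i <= c) -> \sum_(i | P i) f i <= k%:R * c.
Proof.
move=> c0 fc; rewrite mulr_natl -[in X in _ <= X](card_ord k) -sumr_const.
rewrite big_mkcond/=; apply: ler_sum => i _; case: ifP => // Pi; exact: fc.
Qed.

(** If the Gram matrix of [vt] is within [d] of the identity, then Gram-Schmidt
    moves each vector by O(d).  The constant grows with the index of the vector,
    since the displacement of the earlier ones enters its projections; hence
    the induction on the number [m] of vectors treated so far. *)
Lemma gram_schmidt_near_prefix {R : realType} {n k : nat} (m : nat) :
  exists2 C : R, 1 <= C & forall (d : R) (vt v : 'I_k -> 'cV[R]_n),
    0 <= d -> C * d < 1 -> gram_schmidt vt v ->
    (forall i j, `|dot (vt i) (vt j) - (i == j)%:R| <= d) ->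
    forall i : 'I_k, (i < m)%N ->
      l2norm (v i - vt i) <= C * d /\
      forall j : 'I_k, (j <= i)%N -> dot (v i) (v j) = (i == j)%:R.
Proof.
elim: m => [|m [C C1 IH]]; first by exists 1.
have C0 : 0 <= C by lra.
have k0 : 0 <= (k%:R : R) by [].
pose c : R := k%:R * (1 + 2 * C).
have c0 : 0 <= c by rewrite mulr_ge0//; lra.
exists (C + 1 + 2 * c) => [|d vt v d0 Cd gs gram i]; first by lra.
have cd0 : 0 <= c * d by rewrite mulr_ge0.
have Cd0 : 0 <= C * d by rewrite mulr_ge0.
have Cd1 : C * d < 1 by lra.
have {}IH := IH d vt v d0 Cd1 gs gram.
rewrite ltnS leq_eqVlt => /orP[/eqP im|im]; last first.
  by have [le ort] := IH i im; split => //; lra.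
have ort (p q : 'I_k) : (p < i)%N -> (q < i)%N -> dot (v p) (v q) = (p == q)%:R.
  rewrite im => pm qm; have [qp|pq] := leqP q p; first exact: (IH p pm).2.
  by rewrite dotC eq_sym; exact: (IH q qm).2 (ltnW pq).
have nvt : `|l2norm (vt i) - 1| <= d.
  rewrite (le_trans _ (gram i i))// eqxx -l2norm_sqr.
  have -> : l2norm (vt i) ^+ 2 - 1 = (l2norm (vt i) - 1) * (l2norm (vt i) + 1).
    by ring.
  have n0 := l2norm_ge0 (vt i).
  rewrite normrM ler_peMr// ger0_norm; lra.
have nvt2 : l2norm (vt i) <= 2.
  by have := ler_norm (l2norm (vt i) - 1); have : 0 <= c * d by []; lra.
have proj (j : 'I_k) : (j < i)%N -> `|dot (vt i) (v j)| <= (1 + 2 * C) * d.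
  move=> ji; have -> : dot (vt i) (v j) =
      dot (vt i) (vt j) + dot (vt i) (v j - vt j) by rewrite dotBr; ring.
  rewrite (le_trans (ler_normD _ _))// mulrDl mul1r lerD//.
    have := gram i j; rewrite (_ : (i == j) = false) ?subr0//.
    by apply/eqP => ij; rewrite ij ltnn in ji.
  rewrite (le_trans (cauchy_schwarz _ _))// -mulrA.
  by rewrite ler_pM ?l2norm_ge0//; apply: (IH j _).1; rewrite -im.
pose w := vt i - \sum_(j < k | (j < i)%N) dot (vt i) (v j) *: v j.
have vi : v i = (l2norm w)^-1 *: w := gs i.
have wvt : l2norm (w - vt i) <= c * d.
  rewrite l2normBC opprB addrC subrK (le_trans (l2norm_sum _ _ _))// /c -mulrA.
  apply: sum_le_const => [|j ji]; first by rewrite mulr_ge0//; lra.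
  by rewrite l2normZ (l2norm_unit (v j)) ?mulr1 ?proj// ort// eqxx.
have nw : `|1 - l2norm w| <= d + c * d.
  have h1 := l2norm_le_dist w (vt i).
  have h2 := l2norm_le_dist (vt i) w; rewrite l2normBC in h2.
  move: nvt; rewrite !ler_norml => /andP[h3 h4]; apply/andP; split; lra.
have w0 : 0 < l2norm w.
  by have := ler_norm (1 - l2norm w); lra.
have wort (j : 'I_k) : (j < i)%N -> dot w (v j) = 0.
  move=> ji; rewrite dotBl dotC (dotC (\sum_(l < k | _) _)) dot_sumr.
  rewrite (bigD1 j)//= big1 ?addr0 => [|l /andP[li lj]].
    by rewrite dotZr ort// eqxx mulr1 dotC subrr.
  by rewrite dotZr ort// eq_sym (negbTE lj) mulr0.
split.
  have -> : v i - vt i = ((l2norm w)^-1 - 1) *: w + (w - vt i).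
    by rewrite vi scalerBl scale1r addrA subrK.
  rewrite (le_trans (l2normD _ _))// l2normZ.
  have -> : `|(l2norm w)^-1 - 1| * l2norm w = `|1 - l2norm w|.
    rewrite -[X in _ * X](ger0_norm (ltW w0)) -normrM; congr (`|_|).
    by field; rewrite gt_eqF.
  rewrite (le_trans (lerD nw wvt))//; lra.
move=> j; rewrite leq_eqVlt => /orP[/eqP/val_inj ->|ji].
  rewrite eqxx vi dotZl dotZr -l2norm_sqr mulrA -expr2 -exprMn mulVf ?expr1n//.
  by rewrite gt_eqF.
rewrite vi dotZl wort// mulr0; case: eqP => // ij.
by rewrite ij ltnn in ji.
Qed.

Lemma gram_schmidt_near {R : realType} (n k : nat) :
  exists2 C : R, 1 <= C & forall (d : R) (vt v : 'I_k -> 'cV[R]_n),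
    0 <= d -> C * d < 1 -> gram_schmidt vt v ->
    (forall i j, `|dot (vt i) (vt j) - (i == j)%:R| <= d) ->
    orthonormal_family v /\ forall i, l2norm (v i - vt i) <= C * d.
Proof.
have [C C1 h] := @gram_schmidt_near_prefix R n k k.
exists C => // d vt v d0 Cd gs gram.
have {}h i := h d vt v d0 Cd gs gram i (ltn_ord i).
split=> [i j|i]; last exact: (h i).1.
have [ji|ij] := leqP j i; first exact: (h i).2.
by rewrite dotC eq_sym; exact: (h j).2 (ltnW ij).
Qed.

(** * Weighted dyadic maps *)

(** Both the position and the eigenvector directions of the dynamics have this
    form, applied to the force and to the dimer approximation of [H v_i]; the
    weights in the second case are [vweight]. *)
Definition deflate {R : realType} {n k : nat} (c : 'I_k -> R)
    (v : 'I_k -> 'cV[R]_n) (f : 'cV[R]_n) : 'cV[R]_n :=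
  f - \sum_j (c j * dot (v j) f) *: v j.

Section Deflate.
Context {R : realType} {n k : nat}.
Implicit Types (c : 'I_k -> R) (v w : 'I_k -> 'cV[R]_n) (f g : 'cV[R]_n).

Lemma dot_deflate c v f i : orthonormal_family v ->
  dot (v i) (deflate c v f) = (1 - c i) * dot (v i) f.
Proof.
move=> ov; rewrite dotBr dot_sumr (bigD1 i)//= big1 => [|j ji].
  by rewrite dotZr ov eqxx mulr1; ring.
by rewrite dotZr ov eq_sym (negbTE ji) mulr0.
Qed.

(** The weight 2 flips the sign of the component along [v j], so this is a
    reflection. *)
Lemma deflate2_isometry v f : orthonormal_family v ->
  l2norm (deflate (fun=> 2) v f) = l2norm f.
Proof.
move=> ov; apply/eqP; rewrite -(eqrXn2 (ltn0Sn 1)) ?l2norm_ge0// !l2norm_sqr.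
apply/eqP; rewrite {1}/deflate dotBl dotC (dotC (\sum_j _)) dotBl.
rewrite [X in _ - X - _]dotC !dot_sumr -addrA -opprD -big_split/= big1 ?subr0//.
by move=> j _; rewrite !dotZr dotC [X in _ + _ * X]dotC dot_deflate// dotC; ring.
Qed.

Lemma deflate_lipschitz c v w f g (r M : R) : 0 <= r ->
  (forall j, 0 <= c j <= 2) -> (forall j, l2norm (v j) <= r) ->
  (forall j, l2norm (w j) <= r) -> l2norm f <= M -> l2norm g <= M ->
  l2norm (deflate c v f - deflate c w g) <=
  (1 + 2 * k%:R * r ^+ 2) * l2norm (f - g) +
  4 * r * M * \sum_j l2norm (v j - w j).
Proof.
move=> r0 hc hv hw fM gM; have M0 : 0 <= M by exact: le_trans (l2norm_ge0 f) _.
have -> : deflate c v f - deflate c w g = (f - g) -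
    \sum_j (c j * dot (v j) f *: v j - c j * dot (w j) g *: w j).
  rewrite sumrB /deflate; move: (\sum_j _) (\sum_j _) => A B.
  by rewrite !opprB addrACA [RHS]addrACA; congr (_ + _); exact: addrC.
rewrite (le_trans (l2normB _ _))// mulrDl mul1r -addrA lerD2l.
have -> : 2 * k%:R * r ^+ 2 * l2norm (f - g) =
  \sum_(j < k) 2 * r ^+ 2 * l2norm (f - g).
  by rewrite sumr_const card_ord -mulr_natl; ring.
rewrite mulr_sumr -big_split/= (le_trans (l2norm_sum _ _ _))//.
(* Each term is trilinear in [v j], [v j] and [f]: change one argument at a
   time. *)
apply: ler_sum => j _; rewrite -!scalerA -scalerBr l2normZ.
have /andP[c0 c2] := hc j.
set X := l2norm (_ - _ *: _).
suff hX : X <= r ^+ 2 * l2norm (f - g) + 2 * r * M * l2norm (v j - w j).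
  rewrite ger0_norm//; have := @ler_pM _ _ _ X _ c0 (l2norm_ge0 _) c2 hX.
  by lra.
have -> : X = l2norm (dot (v j - w j) f *: v j + dot (w j) (f - g) *: v j +
    dot (w j) g *: (v j - w j)).
  rewrite /X -scalerDl dotBl dotBr subrKA; congr l2norm.
  by rewrite scalerBr scalerBl addrA subrK.
have bnd (a b u : 'cV[R]_n) p q s : l2norm a <= p -> l2norm b <= q ->
    l2norm u <= s -> l2norm (dot a b *: u) <= p * q * s.
  move=> ap bq us; rewrite l2normZ.
  rewrite ler_pM ?l2norm_ge0// (le_trans (cauchy_schwarz _ _))//.
  by rewrite ler_pM ?l2norm_ge0.
have h1 := bnd (v j - w j) f (v j) _ _ _ (lexx _) fM (hv j).
have h2 := bnd (w j) (f - g) (v j) _ _ _ (hw j) (lexx _) (hv j).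
have h3 := bnd (w j) g (v j - w j) _ _ _ (hw j) gM (lexx _).
have := le_trans (l2normD _ _) (lerD (le_trans (l2normD _ _) (lerD h1 h2)) h3).
by move/le_trans; apply; rewrite expr2; lra.
Qed.

Lemma l2norm_deflate c v f (r : R) : 0 <= r ->
  (forall j, 0 <= c j <= 2) -> (forall j, l2norm (v j) <= r) ->
  l2norm (deflate c v f) <= (1 + 2 * k%:R * r ^+ 2) * l2norm f.
Proof.
move=> r0 hc hv.
have := @deflate_lipschitz c v v f 0 r (l2norm f) r0 hc hv hv (lexx _).
rewrite l2norm0 l2norm_ge0 => /(_ isT).
rewrite big1 => [|j _]; last by rewrite subrr l2norm0.
have -> : deflate c v 0 = 0.
  rewrite /deflate sub0r big1 ?oppr0// => j _.
  by rewrite dotC /dot trmx0 mul0mx mxE mulr0 scale0r.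
by rewrite mulr0 addr0 !subr0.
Qed.

End Deflate.

Lemma xdir_deflate {R : realType} {N k : nat} (E : 'cV[R]_N -> R) x
    (v : 'I_k -> 'cV[R]_N) :
  xdir E x v = deflate (fun=> 2) v (force E x).
Proof.
rewrite /xdir mulmxBl mul1mx -scalemxAl mulmx_suml scaler_sumr.
by congr (_ - _); apply: eq_bigr => j _; rewrite mulmx_dyad scalerA.
Qed.

Definition vweight {R : realType} {k : nat} (i j : 'I_k) : R :=
  (j == i)%:R + 2 * (j < i)%N%:R.

Lemma vweight_bound {R : realType} {k : nat} (i j : 'I_k) :
  0 <= (vweight i j : R) <= 2.
Proof.
rewrite /vweight; have [->|_] := eqVneq j i; first by
  rewrite ltnn mulr0 addr0 ler01 ler1n.
by rewrite add0r; case: (j < i)%N; rewrite ?mulr1 ?mulr0 ?lexx ler0n.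
Qed.

Lemma vdir_deflate {R : realType} {N k : nat} (E : 'cV[R]_N -> R) i x
    (v : 'I_k -> 'cV[R]_N) l :
  vdir E i x v l = deflate (vweight i) v (dimer E x (v i) l).
Proof.
rewrite /vdir !mulmxBl mul1mx mulmx_dyad -scalemxAl mulmx_suml scaler_sumr.
rewrite /deflate -addrA -opprD; congr (_ - _).
under [RHS]eq_bigr do rewrite /vweight mulrDl scalerDl.
rewrite big_split/= [X in _ = X + _](bigD1 i)//=.
rewrite [X in _ + X + _]big1 => [|j /negbTE ->].
  rewrite addr0 eqxx mul1r; congr (_ + _); rewrite big_mkcond/=.
  apply: eq_bigr => j _; case: (j < i)%N.
    by rewrite mulmx_dyad scalerA mulr1.
  by rewrite mulr0 mul0r scale0r.
by rewrite mul0r scale0r.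
Qed.

(** * Local estimates for the search directions *)

#[local] Opaque force nhess dimer xdir vdir.

Section LocalEstimates.
Context {R : realType} {N k : nat}.
Variables (E : 'cV[R]_N -> R) (L : R -> R) (lbar : R) (Q1 : R -> R) (r : R).
Hypotheses (hE : twice_differentiable E) (hL : local_lipschitz E L).
Hypotheses (hQ1 : dimer_consistent E lbar Q1) (r0 : 0 < r).
Implicit Types (x y u w : 'cV[R]_N) (v : 'I_k -> 'cV[R]_N) (l : R).

(** The distance in which the theorem measures the error. *)
Definition state_dist x v y (v' : 'I_k -> 'cV[R]_N) : R :=
  l2norm (x - y) + \sum_i l2norm (v i - v' i).

Lemma l2norm_le_state_dist x v y v' i :
  l2norm (x - y) + l2norm (v i - v' i) <= state_dist x v y v'.
Proof.
rewrite lerD2l (bigD1 i)//= lerDl sumr_ge0// => j _; exact: l2norm_ge0.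
Qed.

Let L0 : 0 < L r := (hL r r0).1.
Let Q10 : 0 < Q1 r := (hQ1 r r0).1.
Let r0' : l2norm (0 : 'cV[R]_N) <= r.
Proof. by rewrite l2norm0 ltW. Qed.

Lemma force_bound (s : R) x : 0 < s -> l2norm x <= s ->
  l2norm (force E x) <= l2norm (force E 0) + L s * l2norm x.
Proof.
move=> s0 xs; have z : l2norm (0 : 'cV[R]_N) <= s by rewrite l2norm0 ltW.
have := ((hL s s0).2 0 x z xs).1; rewrite subr0 => h.
by rewrite (le_trans (l2norm_le_dist _ (force E 0)))// lerD2l.
Qed.

Let B := `|opnorm (nhess E 0)| + L r * r.

Let B0 : 0 <= B.
Proof. by rewrite addr_ge0// mulr_ge0// ltW. Qed.

Lemma nhess_mul_bound x u : l2norm x <= r ->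
  l2norm (nhess E x *m u) <= B * l2norm u.
Proof.
move=> xr; have := ((hL r r0).2 0 x r0' xr).2; rewrite subr0 => h.
have -> : nhess E x *m u = nhess E 0 *m u + (nhess E x - nhess E 0) *m u.
  by rewrite mulmxBl addrC subrK.
rewrite (le_trans (l2normD _ _))// mulrDl.
rewrite lerD// (le_trans (opnorm_mulmx _ _ _ _))// ler_wpM2r ?l2norm_ge0//.
  exact: ler_norm.
by rewrite (le_trans h)// ler_wpM2l// ltW.
Qed.

Let MD := Q1 r * lbar ^+ 2 + B * r.

Lemma dimer_bound x u l : l2norm x <= r -> l2norm u <= r ->
  0 < l <= lbar -> l2norm (dimer E x u l) <= MD.
Proof.
move=> xr ur /andP[l0 lb].
rewrite (le_trans (l2norm_le_dist _ (nhess E x *m u)))// addrC lerD//.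
  rewrite (le_trans ((hQ1 r r0).2 _ _ _ xr ur l0 lb))// ler_pM2l//.
  by rewrite ler_pXn2r ?nnegrE// ltW// (lt_le_trans l0).
by rewrite (le_trans (nhess_mul_bound _ _ xr))// ler_wpM2l.
Qed.

(** The Lipschitz constant of the force would control the dimer quotients only
    up to a factor [1/l].  Passing through the Hessian products at both points
    gives constants independent of [l], at the price of [l^2]. *)
Lemma dimer_lipschitz x u y w l :
  l2norm x <= r -> l2norm u <= r -> l2norm y <= r -> l2norm w <= r ->
  0 < l <= lbar ->
  l2norm (dimer E x u l - dimer E y w l) <=
  2 * Q1 r * l ^+ 2 + L r * r * l2norm (x - y) + B * l2norm (u - w).
Proof.
move=> xr ur yr wr /andP[l0 lb].
have split_diff (a b : 'cV[R]_N) (H K : 'M[R]_N) : a - b =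
    (a - H *m u) - (b - K *m w) + ((H - K) *m u + K *m (u - w)).
  by rewrite mulmxBl mulmxBr subrKA opprB addrAC !subrKA.
rewrite (split_diff _ _ (nhess E x) (nhess E y)).
have h1 := (hQ1 r r0).2 _ _ _ xr ur l0 lb.
have h2 := (hQ1 r r0).2 _ _ _ yr wr l0 lb.
have h3 : l2norm ((nhess E x - nhess E y) *m u) <= L r * r * l2norm (x - y).
  rewrite (le_trans (opnorm_mulmx _ _ _ _))// mulrAC.
  rewrite (le_trans (ler_wpM2r (l2norm_ge0 _) ((hL r r0).2 _ _ yr xr).2))//.
  by rewrite ler_wpM2l// mulr_ge0 ?l2norm_ge0// ltW.
have h4 := nhess_mul_bound _ (u - w) yr.
rewrite (le_trans (l2normD _ _))//.
have := l2normB (dimer E x u l - nhess E x *m u)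
                (dimer E y w l - nhess E y *m w).
have := l2normD ((nhess E x - nhess E y) *m u) (nhess E y *m (u - w)).
move: h1 h2 h3 h4; rewrite /= -/B.
move: (l2norm _) (l2norm _) (l2norm _) (l2norm _) (l2norm _) (l2norm _).
by move=> *; lra.
Qed.

Lemma directions_lipschitz : exists A M : R,
  [/\ 0 < A, 0 < M & forall l x v y v', 0 < l <= lbar ->
    l2norm x <= r -> l2norm y <= r ->
    (forall j, l2norm (v j) <= r) -> (forall j, l2norm (v' j) <= r) ->
    l2norm (xdir E x v - xdir E y v') <= A * state_dist x v y v' /\
    forall i,
      l2norm (vdir E i x v l - vdir E i y v' l)
        <= A * (state_dist x v y v' + l ^+ 2) /\
      l2norm (vdir E i x v l) <= M].
Proof.
pose K1 := 1 + 2 * k%:R * r ^+ 2.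
have K10 : 1 <= K1 by rewrite lerDl mulr_ge0 ?sqr_ge0// mulr_ge0.
pose MF := l2norm (force E 0) + L r * r.
have MF0 : 0 < MF by rewrite ltr_wpDl ?l2norm_ge0// mulr_gt0.
have MD0 : 0 <= MD.
  by rewrite addr_ge0// mulr_ge0 ?sqr_ge0 ?(ltW Q10) ?(ltW r0).
have p1 : 0 < K1 * L r by rewrite mulr_gt0//; lra.
have p2 : 0 < K1 * (2 * Q1 r) by rewrite !mulr_gt0//; lra.
have p3 : 0 < K1 * (L r * r) by rewrite !mulr_gt0//; lra.
have p4 : 0 <= K1 * B by rewrite mulr_ge0//; lra.
have p5 : 0 < 4 * r * MF by rewrite !mulr_gt0.
have p6 : 0 <= 4 * r * MD by rewrite !mulr_ge0// ltW.
pose A := K1 * L r + K1 * (2 * Q1 r) + K1 * (L r * r) + K1 * B + 4 * r * MF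
  + 4 * r * MD.
have [A1 A2 A3 A4 A5] : [/\ K1 * L r <= A, K1 * (2 * Q1 r) <= A,
    K1 * (L r * r) <= A, K1 * B + 4 * r * MD <= A & 4 * r * MF <= A].
  by split; rewrite /A; lra.
have A0 : 0 < A by lra.
have mix (a b c X S q : R) : a <= A -> b <= A -> c <= A ->
    0 <= X -> 0 <= S -> 0 <= q -> c * q + a * X + b * S <= A * (X + S + q).
  move=> aA bA cA X0 S0 q0; have := ler_wpM2r X0 aA.
  by have := ler_wpM2r S0 bA; have := ler_wpM2r q0 cA; lra.
have S0 v v' : 0 <= \sum_(j < k) l2norm (v j - v' j).
  by rewrite sumr_ge0// => j _; exact: l2norm_ge0.
exists A, (K1 * (MD + 1)); split => //; first by rewrite mulr_gt0//; lra.
move=> l x v y v' hl xr yr vr v'r; split.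
  have fx z : l2norm z <= r -> l2norm (force E z) <= MF.
    move=> zr; rewrite (le_trans (force_bound _ _ r0 zr))// lerD2l.
    by rewrite ler_wpM2l// ltW.
  have h1 := deflate_lipschitz _ _ _ _ _ _ _ (ltW r0)
    (fun=> introT andP (conj (ler0n R 2) (lexx 2))) vr v'r
    (fx _ xr) (fx _ yr).
  have h2 := ler_wpM2l (le_trans ler01 K10) ((hL r r0).2 _ _ yr xr).1.
  have h3 := mix _ _ 0 _ _ _ A1 A5 (ltW A0)
    (l2norm_ge0 (x - y)) (S0 v v') (lexx 0).
  rewrite !xdir_deflate (le_trans h1)// (le_trans _ (le_trans h3 _))//.
    by rewrite mul0r add0r lerD2r (le_trans h2)// mulrA.
  by rewrite addr0.
move=> i; rewrite !vdir_deflate; split; last first.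
  rewrite (le_trans (l2norm_deflate _ _ _ _ (ltW r0) (vweight_bound i) vr))//.
  rewrite -/K1 ler_wpM2l//; first by lra.
  by rewrite (le_trans (dimer_bound _ _ _ xr (vr i) hl))// lerDl.
have h1 := deflate_lipschitz _ _ _ _ _ _ _ (ltW r0) (vweight_bound i)
  vr v'r (dimer_bound _ _ _ xr (vr i) hl) (dimer_bound _ _ _ yr (v'r i) hl).
have h2 := ler_wpM2l (le_trans ler01 K10)
  (dimer_lipschitz _ _ _ _ _ xr (vr i) yr (v'r i) hl).
have vi : l2norm (v i - v' i) <= \sum_j l2norm (v j - v' j).
  by have := l2norm_le_state_dist x v y v' i; rewrite lerD2l.
have h3 := ler_wpM2l p4 vi.
have h4 := mix _ _ _ _ _ _ A3 A4 A2 (l2norm_ge0 (x - y)) (S0 v v') (sqr_ge0 l).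
rewrite (le_trans h1)// (le_trans _ h4)// -/K1.
move: h2 h3; rewrite -/B -/MD.
move: (l2norm _) (l2norm _) (l2norm _) (\sum_j _).
by move=> *; lra.
Qed.

Lemma dot_mulmx_sym (H : 'M[R]_N) u w : H^T = H ->
  dot u (H *m w) = dot w (H *m u).
Proof. by move=> HT; rewrite dotC /dot trmx_mul HT mulmxA. Qed.

(** With exact Hessian products the projections make the first variation of
    the Gram matrix vanish, because the Hessian is symmetric; the dimer
    approximation leaves O(l^2). *)
Lemma gram_predictor x v l (tau gamma M : R) : orthonormal_family v -> 1 <= r ->
  l2norm x <= r -> 0 < l <= lbar ->
  0 <= tau -> 0 <= gamma ->
  (forall i, l2norm (vdir E i x v l) <= M) ->
  forall i j, `|dot (v i + tau *: (gamma *: vdir E i x v l))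
                     (v j + tau *: (gamma *: vdir E j x v l)) - (i == j)%:R|
    <= tau * gamma * (2 * Q1 r * l ^+ 2) + (tau * gamma) ^+ 2 * M ^+ 2.
Proof.
move=> ov r1 xr /andP[l0 lb] tau0 gamma0 DM i j.
pose h := tau * gamma; have h0 : 0 <= h by exact: mulr_ge0.
pose f i := dimer E x (v i) l.
have v1 m : l2norm (v m) = 1 by exact: orthonormal_l2norm.
have vr m : l2norm (v m) <= r by rewrite v1.
have sym m p : `|dot (v m) (f p) - dot (v p) (f m)| <= 2 * Q1 r * l ^+ 2.
  have replace (a b c d : 'cV[R]_N) : dot (v m) c = dot (v p) d ->
      dot (v m) a - dot (v p) b = dot (v m) (a - c) - dot (v p) (b - d).
    by move=> cd; rewrite !dotBr cd; ring.
  rewrite (replace _ _ _ _ (dot_mulmx_sym _ (v m) (v p) (nhess_sym E L x hE hL))).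
  have cs q s : `|dot (v q) (f s - nhess E x *m v s)| <= Q1 r * l ^+ 2.
    rewrite (le_trans (cauchy_schwarz _ _))// v1 mul1r.
    exact: (hQ1 r r0).2.
  by rewrite (le_trans (ler_normB _ _))// (le_trans (lerD (cs _ _) (cs _ _)))//; lra.
have expand (a b p q : 'cV[R]_N) (s : R) : dot a b = s ->
    dot (a + tau *: (gamma *: p)) (b + tau *: (gamma *: q)) - s =
    h * (dot a q + dot b p) + h ^+ 2 * dot p q.
  by move=> <-; rewrite !(scalerA tau gamma) -/h dotDl !dotDr !dotZl !dotZr
    (dotC p b); ring.
rewrite (expand _ _ _ _ _ (ov i j)).
have tri (a b m1 m2 : R) : `|a| <= m1 -> `|b| <= m2 ->
    `|h * a + h ^+ 2 * b| <= h * m1 + h ^+ 2 * m2.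
  move=> am bm; rewrite (le_trans (ler_normD _ _))// (normrM h) (normrM (h ^+ 2)).
  by rewrite (ger0_norm h0) (ger0_norm (sqr_ge0 h)) lerD// ler_wpM2l// sqr_ge0.
apply: tri; last first.
  apply: le_trans (cauchy_schwarz _ _) _; rewrite expr2.
  by apply: ler_pM; rewrite ?l2norm_ge0.
rewrite !vdir_deflate !dot_deflate// -/(f i) -/(f j) /vweight (eq_sym j i).
clearbody f.
have Ql0 : 0 <= 2 * Q1 r * l ^+ 2 by rewrite mulr_ge0 ?sqr_ge0// mulr_ge0 ?ltW.
have [ij|ji|/val_inj ->] := ltngtP i j.
- rewrite (_ : (i == j) = false) ?add0r; last by apply/eqP => e; rewrite e ltnn in ij.
  rewrite mulr1 mulr0 subr0 mul1r.
  have -> : (1 - 2) * dot (v i) (f j) + dot (v j) (f i) =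
    dot (v j) (f i) - dot (v i) (f j) by ring.
  exact: sym.
- rewrite (_ : (i == j) = false) ?add0r; last by apply/eqP => e; rewrite e ltnn in ji.
  rewrite mulr1 mulr0 subr0 mul1r.
  have -> : dot (v i) (f j) + (1 - 2) * dot (v j) (f i) =
    dot (v i) (f j) - dot (v j) (f i) by ring.
  exact: sym.
- by rewrite eqxx mulr0 addr0 subrr !mul0r addr0 normr0.
Qed.

End LocalEstimates.

(** * One step of the scheme *)

(** Discrete Gronwall inequality.  It is stated as one step of an induction
    because the recursive inequality is only available while the iterates stay
    in a ball, which is itself deduced from the bound at step [n]. *)
Lemma gronwall_step {R : realType} (a0 b c a a' : R) (n : nat) :
  0 <= a0 -> 0 <= b -> 0 <= c -> a' <= (1 + c) * a + b ->
  a <= (a0 + n%:R * b) * expR (n%:R * c) ->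
  a' <= (a0 + n.+1%:R * b) * expR (n.+1%:R * c).
Proof.
move=> a00 b0 c0 a'a an; have n0 : 0 <= n%:R :> R by [].
have e1 : 1 <= expR (n.+1%:R * c) by rewrite -expR0 ler_expR mulr_ge0.
have eS : expR (n.+1%:R * c) = expR (n%:R * c) * expR c.
  by rewrite -expRD -natr1 mulrDl mul1r.
set S := (a0 + n%:R * b) * _ in an.
have S0 : 0 <= S by rewrite mulr_ge0 ?expR_ge0// addr_ge0// mulr_ge0.
have h1 : (1 + c) * a <= (1 + c) * S by rewrite ler_wpM2l// addr_ge0.
have h2 : (1 + c) * S <= expR c * S by rewrite ler_wpM2r// expR_ge1Dx.
have -> : (a0 + n.+1%:R * b) * expR (n.+1%:R * c) =
    expR c * S + b * expR (n.+1%:R * c).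
  by rewrite eS -natr1 /S; ring.
have h3 : b * 1 <= b * expR (n.+1%:R * c) by rewrite ler_wpM2l.
by lra.
Qed.

Lemma gronwall_mono {R : realType} (a0 b c : R) (n m : nat) :
  0 <= a0 -> 0 <= b -> 0 <= c -> (n <= m)%N ->
  (a0 + n%:R * b) * expR (n%:R * c) <= (a0 + m%:R * b) * expR (m%:R * c).
Proof.
move=> a00 b0 c0 nm; have nmR : n%:R <= m%:R :> R by rewrite ler_nat.
rewrite ler_pM ?expR_ge0//; first by rewrite addr_ge0// mulr_ge0.
  by rewrite lerD2l ler_wpM2r.
by rewrite ler_expR ler_wpM2r.
Qed.

(** Euler step from [a] with slope [D'], perturbed by at most [eta], against a
    function with slope [D] whose truncation error is at most [rho]. *)
Lemma euler_error {R : realType} {n : nat} (g g1 D tr a a1 D' : 'cV[R]_n)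
    (tau rho eta : R) : 0 <= tau ->
  g1 = g + tau *: (D + tr) -> l2norm tr <= rho ->
  l2norm (a1 - (a + tau *: D')) <= eta ->
  l2norm (g1 - a1) <= l2norm (g - a) + tau * l2norm (D - D') + (tau * rho + eta).
Proof.
move=> tau0 -> trr pert.
have -> : g + tau *: (D + tr) - a1 =
    (g - a) + tau *: (D - D') + (tau *: tr - (a1 - (a + tau *: D'))).
  rewrite scalerDr scalerBr; move: (tau *: D) (tau *: D') (tau *: tr) => p q s.
  by apply/matrixP => i j; rewrite !mxE; ring.
have h1 := l2normD ((g - a) + tau *: (D - D'))
                   (tau *: tr - (a1 - (a + tau *: D'))).
have h2 := l2normD (g - a) (tau *: (D - D')).
have h3 := l2normB (tau *: tr) (a1 - (a + tau *: D')).
rewrite !l2normZ (ger0_norm tau0) in h2 h3.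
have h4 := ler_wpM2l tau0 trr.
by move: h1 h2 h3; move: (l2norm _) (l2norm _) (l2norm _) => *; lra.
Qed.

Section SchemeStep.
Context {R : realType} {N : nat}.
Variables (k : nat) (E : 'cV[R]_N -> R) (L : R -> R) (lbar : R) (Q1 : R -> R).
Hypotheses (hE : twice_differentiable E) (hL : local_lipschitz E L).
Hypotheses (hQ1 : dimer_consistent E lbar Q1).
Implicit Types (x : 'cV[R]_N) (v : 'I_k -> 'cV[R]_N).

(** The position update moves along a reflection of the force, so the scheme
    satisfies the growth estimate of the gradient flow. *)
Lemma position_growth x v (tau beta s : R) : 0 <= tau -> 0 <= beta ->
  0 < s -> l2norm x <= s -> orthonormal_family v ->
  l2norm (x + tau *: (beta *: xdir E x v)) <=
  (1 + tau * (beta * L s)) * l2norm x + tau * (beta * l2norm (force E 0)).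
Proof.
move=> tau0 beta0 s0 xs ov.
have refl : l2norm (xdir E x v) = l2norm (force E x).
  by rewrite xdir_deflate; exact: deflate2_isometry.
have h := ler_wpM2l (mulr_ge0 tau0 beta0) (force_bound E L hL s x s0 xs).
rewrite -{}refl in h.
move: (xdir _ _ _) (l2norm (force E 0)) h => d f0 h.
rewrite (le_trans (l2normD _ _))// !l2normZ (ger0_norm tau0) (ger0_norm beta0).
by lra.
Qed.

(** The predictor is orthonormal up to [tau l^2 + tau^2]; under [l^2 = O(tau)]
    the Gram-Schmidt correction is of the order of the truncation error. *)
Lemma gram_schmidt_correction (gamma C0 r M : R) : 0 < gamma -> 0 <= C0 ->
  1 <= r ->
  exists2 G : R, 0 < G & forall tau l x v v',
    0 < tau -> G * tau ^+ 2 < 1 -> 0 < l <= lbar -> l ^+ 2 <= C0 * tau ->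
    l2norm x <= r -> (forall i, l2norm (vdir E i x v l) <= M) ->
    orthonormal_family v ->
    gram_schmidt (fun i => v i + tau *: (gamma *: vdir E i x v l)) v' ->
    orthonormal_family v' /\
    forall i, l2norm (v' i - (v i + tau *: (gamma *: vdir E i x v l)))
                <= G * tau ^+ 2.
Proof.
move=> gamma0 C00 r1; have r0 : 0 < r by lra.
have [C C1 gsC] := @gram_schmidt_near R N k.
have Q10 := (hQ1 r r0).1.
pose D := gamma * (2 * Q1 r * C0) + gamma ^+ 2 * M ^+ 2 + 1.
have D0 : 0 < D.
  rewrite ltr_wpDl// addr_ge0//; last by rewrite mulr_ge0 ?sqr_ge0.
  exact: mulr_ge0 (ltW gamma0) (mulr_ge0 (mulr_ge0 (ler0n R 2) (ltW Q10)) C00).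
exists (C * D) => [|tau l x v v' tau0 Gt hl lC xr vM ov gs].
  by rewrite mulr_gt0//; lra.
rewrite -mulrA in Gt *.
apply: gsC gs _ => //; first by rewrite mulr_ge0 ?sqr_ge0// ltW.
move=> i j; apply: le_trans.
  apply: (gram_predictor E L lbar Q1 r hE hL hQ1 r0 x v l tau gamma M ov r1 xr
    hl (ltW tau0) (ltW gamma0) vM i j).
have h : tau * gamma * (2 * Q1 r) * l ^+ 2 <= tau * gamma * (2 * Q1 r) * (C0 * tau).
  by rewrite ler_wpM2l// !mulr_ge0// ltW.
by rewrite /D; have := sqr_ge0 tau; lra.
Qed.

End SchemeStep.

(** * Convergence *)

Lemma trunc_err_taylor {R : realType} {N : nat} (T : R) (K : nat)
    (g : R -> 'cV[R]_N) (m : nat) : step T K != 0 ->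
  g (m.+1%:R * step T K) = g (m%:R * step T K) +
    step T K *: (derive_on `[0, T] g (m%:R * step T K) + trunc_err T K g m).
Proof.
move=> tau0; rewrite /trunc_err /=; move: (derive_on _ _ _) => d.
by rewrite (addrC d) subrK scalerA divff// scale1r addrC subrK.
Qed.

Theorem theorem4p1 (R : realType) (N k : nat) (hN : (1 <= N)%N) (hk : (1 <= k)%N)
  (T beta gamma : R) (hT : 0 < T) (hbeta : 0 < beta) (hgamma : 0 < gamma)
  (E : 'cV[R]_N -> R) (hE : twice_differentiable E)
  (L : R -> R) (hL : local_lipschitz E L)
  (lbar : R) (Q1 : R -> R) (hQ1 : dimer_consistent E lbar Q1)
  (x0 : 'cV[R]_N) (v0 : 'I_k -> 'cV[R]_N)
  (hv0 : forall i j, dot (v0 i) (v0 j) = (i == j)%:R)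
  (eps0 eps0' r0 r0' : R) (heps0 : 0 < eps0) (heps0' : 0 < eps0')
  (hr0 : pnorm x0 v0 + eps0 <= r0) (hr0' : l2norm x0 + eps0' <= r0')
  (l0 : R -> R)
  (hl0 : forall K : nat, (1 <= K)%N -> 0 < l0 (step T K) <= lbar)
  (Q2 : R) (hQ2 : 0 < Q2)
  (hQ2l : forall K : nat, (1 <= K)%N ->
    vdir_lipschitz k E r0 Q2 (l0 (step T K)))
  (hS : forall K : nat, (1 <= K)%N -> forall i : 'I_k,
    Sbound E beta gamma T L Q1 x0 v0 r0 Q2 (l0 (step T K)) i <= pnorm x0 v0 + eps0)
  (hx : (l2norm x0 + beta * T * l2norm (force E 0)) * expR (beta * L r0' * T)
          <= l2norm x0 + eps0')
  (C0 : R)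
  (hC0 : forall K : nat, (1 <= K)%N -> l0 (step T K) ^+ 2 <= C0 * step T K)
  (x : nat -> R -> 'cV[R]_N) (v : nat -> 'I_k -> R -> 'cV[R]_N)
  (l : nat -> R -> R)
  (hsol : forall K : nat, (1 <= K)%N ->
    sd_solution E beta gamma T x0 v0 (l0 (step T K)) (x K) (v K) (l K))
  (C1 : R)
  (htrunc : forall K n : nat, (n < K)%N ->
    l2norm (trunc_err T K (x K) n) <= C1 * step T K /\
    forall i, l2norm (trunc_err T K (v K i) n) <= C1 * step T K)
  (xh : nat -> nat -> 'cV[R]_N) (vh : nat -> nat -> 'I_k -> 'cV[R]_N)
  (hscheme : forall K : nat, (1 <= K)%N ->
    euler_gs_solution E beta gamma T x0 v0 (l0 (step T K)) K (xh K) (vh K)) :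
  exists Q : R, 0 < Q /\ exists tau0 : R, 0 < tau0 /\
    forall K : nat, (1 <= K)%N -> step T K <= tau0 ->
      \big[Num.max/0]_(1 <= n < K.+1)
        (l2norm (x K (n%:R * step T K) - xh K n)
         + \sum_i l2norm (v K i (n%:R * step T K) - vh K n i))
      <= Q * step T K.
Proof.
have s0 : 0 < r0' by have := l2norm_ge0 x0; lra.
(* The scheme stays in the ball of radius [r0'] and its directions are unit
   vectors; the added 2 leaves room for an error of size 1 in either. *)
pose r := r0' + 2.
have r1 : 1 <= r by rewrite /r; lra.
have r_gt0 : 0 < r by lra.
have tau_gt0 K : (1 <= K)%N -> 0 < step T K by move=> K1; rewrite divr_gt0// ltr0n.
have C00 : 0 <= C0.
  have := le_trans (sqr_ge0 _) (hC0 1%N isT).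
  by rewrite pmulr_lge0// tau_gt0.
have C10 : 0 <= C1.
  have := le_trans (l2norm_ge0 _) (htrunc 1%N 0%N isT).1.
  by rewrite pmulr_lge0// tau_gt0.
have [A [M [A0 M0 dirs]]] :=
  @directions_lipschitz R N k E L lbar Q1 r hL hQ1 r_gt0.
have [G G0 correct] := gram_schmidt_correction k E L lbar Q1 hE hL hQ1
  gamma C0 r M hgamma C00 r1.
(* [A'] is the growth rate of the error, [B] the size of the local error. *)
pose A' := beta * A + k%:R * (gamma * A).
pose B := C1 + k%:R * (gamma * A * C0 + C1 + G).
have A'0 : 0 <= A'.
  by rewrite addr_ge0// ltW// mulr_gt0// ?mulr_gt0// ltr0n.
have B0 : 0 <= B.
  rewrite addr_ge0// mulr_ge0// !addr_ge0// ?(ltW G0)//.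
  exact: mulr_ge0 (ltW (mulr_gt0 hgamma A0)) C00.
pose Q := T * B * expR (T * A') + 1.
have TBe : 0 <= T * B * expR (T * A').
  exact: mulr_ge0 (mulr_ge0 (ltW hT) B0) (expR_ge0 _).
have Q0 : 0 < Q by rewrite /Q; lra.
(* For such [tau] one has [tau <= 1], [Q tau <= 1] and [G tau^2 < 1]. *)
exists Q; split=> //; exists (Q + G + 1)^-1; split; first by rewrite invr_gt0; lra.
move=> K K1; have := tau_gt0 K K1.
have KT : K%:R * step T K = T by rewrite /step mulrC divfK// pnatr_eq0 -lt0n.
have [x00 v00 len0 dyn] := hsol K K1.
have [xh0 vh0 stp] := hscheme K K1.
have /andP[l00 l0b] := hl0 K K1.
have l0sq := hC0 K K1.
have trunc n : (n < K)%N -> _ := htrunc K n.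
have taylor (g : R -> 'cV[R]_N) n := @trunc_err_taylor R N T K g n.
move: stp len0 l0sq trunc taylor; rewrite /euler_gs_solution /=.
move: (trunc_err T K) => terr.
move: (step T K) KT l00 l0b => tau KT l00 l0b stp len0 l0sq trunc taylor tau0 tauQ.
have {}tauQ : tau * (Q + G + 1) <= 1.
  by rewrite -ler_pdivlMr ?div1r//; lra.
have Qtau : Q * tau <= 1.
  have := mulr_ge0 (ltW tau0) (ltW G0); lra.
have Gtau : G * tau ^+ 2 < 1.
  have := mulr_gt0 tau0 Q0; have := mulr_gt0 tau0 G0 => h1 h2.
  have tau1 : tau <= 1 by lra.
  by have := ler_wpM2l (ltW h1) tau1; rewrite expr2; lra.
have time n : (n <= K)%N -> 0 <= n%:R * tau <= T.
  move=> nK; rewrite -KT mulr_ge0 ?(ltW tau0)//=.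
  by rewrite ler_wpM2r ?(ltW tau0)// ler_nat.
have len n : (n <= K)%N -> l K (n%:R * tau) = expR (- (n%:R * tau)) * l0 tau.
  move=> nK; rewrite [RHS]mulrC -len0.
  apply: (dimer_length T (l K) _ _ (time n nK)) => t ht.
  by have [_ _] := dyn t ht.
have dimer_len n : (n <= K)%N -> let l := expR (- (n%:R * tau)) * l0 tau in
    0 < l <= lbar /\ l ^+ 2 <= C0 * tau.
  move=> nK /=; have /andP[t0 _] := time n nK.
  have e1 : expR (- (n%:R * tau)) <= 1 by rewrite -[leRHS]expR0 ler_expR oppr_le0.
  have ll0 : expR (- (n%:R * tau)) * l0 tau <= l0 tau by rewrite ler_piMl// ltW.
  have l_gt0 : 0 < expR (- (n%:R * tau)) * l0 tau by rewrite mulr_gt0// expR_gt0.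
  split; first by rewrite l_gt0 (le_trans ll0).
  by apply: le_trans l0sq; rewrite ler_pXn2r// nnegrE ltW.
pose bx := tau * (beta * l2norm (force E 0)); pose cx := tau * (beta * L r0').
pose be := B * tau ^+ 2; pose ce := tau * A'.
have bx0 : 0 <= bx.
  by rewrite mulr_ge0 ?(ltW tau0)// mulr_ge0 ?l2norm_ge0// ltW.
have cx0 : 0 <= cx.
  by rewrite mulr_ge0 ?(ltW tau0)// mulr_ge0 ?(ltW hbeta)// ltW// (hL _ s0).1.
have be0 : 0 <= be by rewrite mulr_ge0 ?sqr_ge0.
have ce0 : 0 <= ce by rewrite mulr_ge0// ltW.
pose err n := state_dist (x K (n%:R * tau)) (fun i => v K i (n%:R * tau))
  (xh K n) (vh K n).
have x_bounded n : (n <= K)%N ->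
    l2norm (xh K n) <= (l2norm x0 + n%:R * bx) * expR (n%:R * cx) ->
    l2norm (xh K n) <= r0'.
  move=> nK /le_trans; apply; rewrite (le_trans _ hr0')// (le_trans _ hx)//.
  have := gronwall_mono _ _ _ _ _ (l2norm_ge0 x0) bx0 cx0 nK.
  have -> : K%:R * bx = beta * T * l2norm (force E 0) by rewrite -KT /bx; ring.
  by have -> : K%:R * cx = beta * L r0' * T by rewrite -KT /cx; ring.
have err_small n : (n <= K)%N ->
    err n <= (0 + n%:R * be) * expR (n%:R * ce) -> err n <= Q * tau.
  move=> nK /le_trans; apply.
  apply: le_trans (gronwall_mono _ _ _ _ _ (lexx 0) be0 ce0 nK) _.
  have -> : K%:R * ce = T * A' by rewrite -KT /ce; ring.
  have -> : K%:R * be = T * B * tau by rewrite -KT /be; ring.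
  by rewrite add0r mulrAC ler_pM2r// /Q lerDl.
(* The three bounds depend on each other: the growth estimate needs
   orthonormality, and both the next Gram-Schmidt step and the error recursion
   need all points to be in the ball of radius [r]. *)
have main n : (n <= K)%N ->
  [/\ orthonormal_family (vh K n),
      l2norm (xh K n) <= (l2norm x0 + n%:R * bx) * expR (n%:R * cx) &
      err n <= (0 + n%:R * be) * expR (n%:R * ce)].
  elim: n => [_|n IH nK].
    rewrite !mul0r !addr0 expR0 mulr1 xh0; split=> //.
      by move=> i j; rewrite !vh0 hv0.
    rewrite mul0r /err /state_dist mul0r x00 xh0 subrr l2norm0 add0r big1// => i _.
    by rewrite v00 vh0 subrr l2norm0.
  have {}IH := IH (ltnW nK); case: IH => ov xhn errn.
  have xhr := x_bounded n (ltnW nK) xhn.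
  have err1 : err n <= 1 := le_trans (err_small n (ltnW nK) errn) Qtau.
  have [hl lsq] := dimer_len n (ltnW nK).
  have [xstep vstep] := stp n nK.
  have [[_ dx] dv _] := dyn _ (time n (ltnW nK)).
  have [tx tv] := trunc n nK.
  rewrite (len n (ltnW nK)) in dv.
  set t := n%:R * tau in dx dv hl lsq vstep *.
  set l_n := expR (- t) * l0 tau in dv hl lsq vstep.
  have ex : l2norm (x K t - xh K n) <= err n.
    by rewrite lerDl sumr_ge0// => i _; exact: l2norm_ge0.
  have ev i : l2norm (v K i t - vh K n i) <= err n.
    apply: le_trans (l2norm_le_state_dist (x K t) (fun i => v K i t) _ _ i).
    by rewrite lerDr l2norm_ge0.
  have xhr' : l2norm (xh K n) <= r by rewrite (le_trans xhr)// lerDl.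
  have vhr i : l2norm (vh K n i) <= r by rewrite orthonormal_l2norm.
  have xr : l2norm (x K t) <= r.
    rewrite (le_trans (l2norm_le_dist _ (xh K n)))// lerD//.
    by rewrite (le_trans ex)// (le_trans err1)// ler1n.
  have vr i : l2norm (v K i t) <= r.
    rewrite (le_trans (l2norm_le_dist _ (vh K n i)))// orthonormal_l2norm//.
    rewrite (le_trans (lerD (lexx 1) (le_trans (ev i) err1)))//.
    by rewrite /r lerDr ltW.
  have [dX dV] := dirs l_n _ (fun i => v K i t) _ (vh K n) hl xr xhr' vr vhr.
  have [_ dVh] := dirs l_n _ (vh K n) _ (vh K n) hl xhr' xhr' vhr vhr.
  have [ov' corr] := correct tau l_n (xh K n) (vh K n) (vh K n.+1) tau0 Gtau hl
    lsq xhr' (fun i => (dVh i).2) ov vstep.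
  split=> //.
    apply: (gronwall_step _ _ _ _ _ _ (l2norm_ge0 x0) bx0 cx0 _ xhn).
    rewrite xstep.
    exact: position_growth k E L hL _ _ _ _ _ (ltW tau0) (ltW hbeta) s0 xhr ov.
  apply: (gronwall_step _ _ _ _ _ _ (lexx 0) be0 ce0 _ errn).
  have tau_neq0 : tau != 0 by rewrite gt_eqF.
  have taylor_x := taylor (x K) n tau_neq0; rewrite dx in taylor_x.
  have xpert : l2norm (xh K n.+1 - (xh K n + tau *: (beta *: xdir E (xh K n)
    (vh K n)))) <= 0 by rewrite xstep subrr l2norm0.
  have hX := euler_error _ _ _ _ _ _ _ _ _ _ (ltW tau0) taylor_x tx xpert.
  pose c := tau * (gamma * (A * (err n + C0 * tau))) +
    (tau * (C1 * tau) + G * tau ^+ 2).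
  have hV i : l2norm (v K i (n.+1%:R * tau) - vh K n.+1 i) <=
      l2norm (v K i t - vh K n i) + c.
    have taylor_v := taylor (v K i) n tau_neq0; rewrite (dv i).2 in taylor_v.
    have := euler_error _ _ _ _ _ _ _ _ _ _ (ltW tau0) taylor_v (tv i) (corr i).
    move=> /le_trans; apply; rewrite /c -addrA lerD2l lerD2r ler_pM2l//.
    rewrite -scalerBr l2normZ (ger0_norm (ltW hgamma)) ler_pM2l//.
    by apply: le_trans (dV i).1 _; rewrite ler_pM2l// lerD2l.
  have sumV : \sum_i l2norm (v K i (n.+1%:R * tau) - vh K n.+1 i) <=
      \sum_i l2norm (v K i t - vh K n i) + k%:R * c.
    have -> : k%:R * c = \sum_(i < k) c by rewrite sumr_const card_ord mulr_natl.
    by rewrite -big_split/=; apply: ler_sum => i _; exact: hV.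
  have hX' : l2norm (beta *: xdir E (x K t) (fun i => v K i t) -
      beta *: xdir E (xh K n) (vh K n)) <= beta * (A * err n).
    by rewrite -scalerBr l2normZ (ger0_norm (ltW hbeta)) ler_pM2l.
  have hX2 := ler_wpM2l (ltW tau0) hX'.
  have := lerD (le_trans hX (lerD (lerD (lexx _) hX2) (lexx _))) sumV.
  move=> /le_trans; apply.
  have -> : (1 + ce) * err n + be = err n + tau * (beta * (A * err n)) +
      tau * (C1 * tau) + k%:R * c.
    by rewrite /ce /be /c /A' /B; ring.
  have : err n = l2norm (x K t - xh K n) + \sum_i l2norm (v K i t - vh K n i).
    by [].
  by move: (err n) (k%:R * c) (l2norm _) (\sum_i _) => *; lra.
rewrite big_nat; apply: bigmax_le => [|n /andP[_ nK]].
  by rewrite mulr_ge0// ltW.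
have [_ _ errn] := main n nK.
exact: err_small nK errn.
Qed.
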